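(* The preprocessing algorithm described in the context (Algorithm P), applied to (HOPnr1($\underline z,\overline z$)), does not affect the feasible region of (HOPnr1($\underline z,\overline z$)). When Algorithm P terminates, either there exists a feasible solution $\tilde s$ of (HOPnr1($\underline z,\overline z$)) whose scheme satisfies $\tilde T_{out}^{S_j}=\overline T_{out}^{S_j}$ for all $j=1,\dots,N^S-1$ (where $\overline T_{out}^{S_j}$ are the bounds at termination), or it returns that (HOPnr1($\underline z,\overline z$)) is infeasible.
   Context: Data of the heated oil pipeline (HOP) problem. There are $N^S$ stations $j=1,\dots,N^S$; the pipe between stations $j$ and $j+1$ is divided into $N^P_j\ge 1$ segments $r=1,\dots,N^P_j$. The given constants are: $C_p,C_f,V_c,\rho,c,g$; efficiencies $\xi_j^{CP},\xi_j^{SP},\eta_j$; volume flows $Q_{jr}$ ($r\ge 0$); lengths $L_{jr}$; inner and outer diameters $D_{jr},d_{jr}$; heat transfer coefficients $K_{jr}$; elevation differences $\Delta Z_{jr}\in\mathbb R$; pump heads $H_j^{CP}$ and $\underline H_j^{SP}\le\overline H_j^{SP}$; temperatures $T_g^{P_{jr}},T_f^{P_{jr}}$; integer bounds $\underline z=(\underline x,\underline y)\le\overline z=(\overline x,\overline y)$; and the lower and upper bounds (underlined/overlined) on heads and temperatures appearing below. All constants related to price, efficiency, flow, length, diameter, head, temperature and friction are nonnegative, and those occurring in denominators, as well as $Q_{jr},D_{jr}$, are positive. Put $\alpha_{jr}=K_{jr}\pi d_{jr}/(\rho Q_{jr}c)$. $f(T,Q,D)$ is a given real-valued function (evaluated at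 positive temperatures $T$). The inlet head and temperature of station 1 are given: $\underline H_{in}^{S_1}=\overline H_{in}^{S_1}$, $\underline T_{in}^{S_1}=\overline T_{in}^{S_1}$. Standing assumption: for all fixed $Q>0$, $D>0$, $T\mapsto f(T,Q,D)$ is convex and strictly monotonically decreasing for $T>0$. Variables (a scheme $\Psi$): $x_j,y_j,\Delta H_j^{SP},\Delta T_j,H_{out}^{S_j},T_{out}^{S_j}$ ($1\le j\le N^S-1$); $H_{in}^{S_j},T_{in}^{S_j}$ ($1\le j\le N^S$); $H_{out}^{P_{jr}},T_{out}^{P_{jr}}$ ($0\le r\le N^P_j$) and $T_{ave}^{P_{jr}},F_{jr}$ ($1\le r\le N^P_j$), for $1\le j\le N^S-1$. Write $z=(x,y)$. Constraints (for $j=1,\dots,N^S-1$ and $r=1,\dots,N^P_j$ unless specified): (a) $H_{out}^{P_{jr}}=H_{out}^{P_{j,r-1}}-F_{jr}-\Delta Z_{jr}$; (b) $F_{jr}=f(T_{ave}^{P_{jr}},Q_{jr},D_{jr})L_{jr}$; (c) $T_{out}^{P_{jr}}=T_g^{P_{jr}}+T_f^{P_{jr}}+[T_{out}^{P_{j,r-1}}-(T_g^{P_{jr}}+T_f^{P_{jr}})]e^{-\alpha_{jr}L_{jr}}$; (d) $T_{ave}^{P_{jr}}=\frac13T_{out}^{P_{j,r-1}}+\frac23T_{out}^{P_{jr}}$; (e) $H_{in}^{S_j}+x_jH_j^{CP}+\Delta H_j^{SP}\ge H_{out}^{S_j}$; (f) $y_j\underline H_j^{SP}\le\Delta H_j^{SP}\le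 y_j\overline H_j^{SP}$; (g) $T_{in}^{S_j}+\Delta T_j=T_{out}^{S_j}$, $\Delta T_j\ge0$; (h) $T_{out}^{P_{j0}}=T_{out}^{S_j}$, $T_{out}^{P_{jN^P_j}}=T_{in}^{S_{j+1}}$, $H_{out}^{P_{j0}}=H_{out}^{S_j}$, $H_{out}^{P_{jN^P_j}}=H_{in}^{S_{j+1}}$; (i) $\underline H_{in}^{S_j}\le H_{in}^{S_j}\le\overline H_{in}^{S_j}$ and $\underline T_{in}^{S_j}\le T_{in}^{S_j}\le\overline T_{in}^{S_j}$ for $j=1,\dots,N^S$; $\underline H_{out}^{S_j}\le H_{out}^{S_j}\le\overline H_{out}^{S_j}$ and $\underline T_{out}^{S_j}\le T_{out}^{S_j}\le\overline T_{out}^{S_j}$ for $j\le N^S-1$; $\underline H_{out}^{P_{jr}}\le H_{out}^{P_{jr}}\le\overline H_{out}^{P_{jr}}$ for $r=1,\dots,N^P_j-1$; (k) $x_j\in[\underline x_j,\overline x_j]$, $y_j\in[\underline y_j,\overline y_j]$ (real). (HOPnr1($\underline z,\overline z$)): minimize $C(x,\Delta H^{SP},\Delta T)=\sum_{j=1}^{N^S-1}\big[C_p\rho Q_{j0}g\big(\frac{x_jH_j^{CP}}{\xi_j^{CP}}+\frac{\Delta H_j^{SP}}{\xi_j^{SP}}\big)+C_fc\rho Q_{j0}\frac{\Delta T_j}{\eta_jV_c}\big]$ over $\Psi$ subject to (a)-(i),(k). A vector $s=(z,\Delta H^{SP},\Delta T,H_{out}^S)$ determines a unique scheme satisfying all equality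 constraints; $s$ is feasible if this scheme satisfies all inequality constraints. Notation: $\underline H_{out}^{P_{j0}}:=\underline H_{out}^{S_j}$, $\overline H_{out}^{P_{j0}}:=\overline H_{out}^{S_j}$, $\underline H_{out}^{P_{jN^P_j}}:=\underline H_{in}^{S_{j+1}}$, $\overline H_{out}^{P_{jN^P_j}}:=\overline H_{in}^{S_{j+1}}$. Write $B_{jr}=T_g^{P_{jr}}+T_f^{P_{jr}}$ and $e_{jr}=\exp(-\alpha_{jr}L_{jr})$. For $0\le r_0<r_0+r\le N_j^P$ set $\phi_{jr}^{r_0}=\frac13[1+2e_{j,r_0+r}]\prod_{t=1}^{r-1}e_{j,r_0+t}$, $\psi_{jr}^{r_0}=\frac13[1+2e_{j,r_0+r}]\sum_{t=1}^{r-1}B_{j,r_0+t}[1-e_{j,r_0+t}]\prod_{k=t+1}^{r-1}e_{j,r_0+k}+\frac23B_{j,r_0+r}[1-e_{j,r_0+r}]$, so that (c),(d) give $T_{ave}^{P_{j,r_0+r}}=\phi_{jr}^{r_0}T_{out}^{P_{jr_0}}+\psi_{jr}^{r_0}$. Algorithm P. For $j=N^S-1,N^S-2,\dots,1$ do: 1. Domain propagation: shrink the bounds on $H_{out}^{S_j},H_{in}^{S_{j+1}},T_{out}^{S_j},T_{in}^{S_{j+1}}$ as implied by (c), (h) and the bounds on $T_{out}^{S_j}$, $H_{in}^{S_{j+1}}$, $T_{in}^{S_{j+1}}$, without affecting the feasible region (in particular, every $T_{out}^{S_j}$ within its propagated bounds yields through (c),(h) a $T_{in}^{S_{j+1}}$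 within its bounds). 2. Let $T_{out}^{S_j}:=\overline T_{out}^{S_j}$ and compute $T_{out}^{P_{jr}},T_{ave}^{P_{jr}},F_{jr}$ ($r=1,\dots,N_j^P$) and $T_{in}^{S_{j+1}}$ from (b),(c),(d),(h). 3. Let $H_{out}^{S_j}:=\underline H_{out}^{S_j}$ and compute $H_{out}^{P_{jr}}$, $r=0,\dots,N_j^P$, from (a),(h). 4. Let $r_0\in\arg\max_{r=0,\dots,N_j^P}\{\underline H_{out}^{P_{jr}}-H_{out}^{P_{jr}}\}$, $\delta H:=\underline H_{out}^{P_{jr_0}}-H_{out}^{P_{jr_0}}$, and update $H_{out}^{P_{jr}}:=H_{out}^{P_{jr}}+\delta H$ for all $r$ (hence also $H_{out}^{S_j}=H_{out}^{P_{j0}}$). 5. If there is $r_1\in\{0,\dots,N_j^P\}$ with $H_{out}^{P_{jr_1}}>\overline H_{out}^{P_{jr_1}}$: if $r_1<r_0$, return ''infeasible''. Otherwise solve for $u\in\mathbb R$ the equation $\overline H_{out}^{P_{jr_1}}=\underline H_{out}^{P_{jr_0}}-\sum_{t=1}^{r_1-r_0}[f(\phi_{jt}^{r_0}u+\psi_{jt}^{r_0},Q_{j,r_0+t},D_{j,r_0+t})L_{j,r_0+t}+\Delta Z_{j,r_0+t}]$; if it has no solution, return ''infeasible''; otherwise set $\overline T_{out}^{S_j}:=\sum_{t=1}^{r_0}B_{jt}[1-\exp(\alpha_{jt}L_{jt})]\prod_{k=1}^{t-1}\exp(\alpha_{jk}L_{jk})+\prod_{t=1}^{r_0}\exp(\alpha_{jt}L_{jt})\,u$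 with $u$ the solution, and go to step 2. 6. Set $\underline H_{out}^{S_j}:=H_{out}^{S_j}$, $\underline H_{in}^{S_j}:=\max\{\underline H_{in}^{S_j},\underline H_{out}^{S_j}-\overline x_jH_j^{CP}-\overline y_j\overline H_j^{SP}\}$, $\overline T_{in}^{S_j}:=\min\{\overline T_{in}^{S_j},\overline T_{out}^{S_j}\}$. 7. If some lower bound in (i) is strictly larger than the corresponding upper bound, return ''infeasible''. After the loop, return ''feasible''.
   Formalization: The upper bounds on y_j are assumed nonnegative (y_j counts pumps): if one is negative and the lower and upper SP heads differ, (f) is unsatisfiable but Algorithm P may still return ''feasible''. *)

(* Defs.v *)
(* MathComp / MathComp-Analysis. *)
From HB Require Import structures.
From mathcomp Require Import all_boot all_order all_algebra.
From mathcomp Require Import all_classical all_reals all_analysis.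
From Stdlib Require Import Relation_Operators.

Set Implicit Arguments.
Unset Strict Implicit.
Unset Printing Implicit Defensive.

Import Order.TTheory GRing.Theory Num.Theory.

Local Open Scope classical_set_scope.
Local Open Scope ring_scope.

(* Stations, pipes and segments keep their one-based numbering: station j with
   1 <= j <= NS, pipe j (from station j to station j + 1) with 1 <= j < NS,
   and segment r of pipe j with 1 <= r <= NP j.  Families are functions on
   nat; their values outside these ranges are never constrained. *)
Record hop (R : realType) := Hop {
  NS : nat;
  NP : nat -> nat;
  price_p : R;                      (* C_p *)
  price_f : R;                      (* C_f *)
  Vc : R;
  rho : R;
  heatcap : R;                      (* c *)
  grav : R;                         (* g *)
  xiCP : nat -> R;
  xiSP : nat -> R;
  eta : nat -> R;
  flow : nat -> nat -> R;           (* Q_{jr}, r >= 0 *)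
  len : nat -> nat -> R;            (* L_{jr} *)
  din : nat -> nat -> R;            (* inner diameter D_{jr} *)
  dout : nat -> nat -> R;           (* outer diameter d_{jr} *)
  htc : nat -> nat -> R;            (* heat transfer coefficient K_{jr} *)
  dZ : nat -> nat -> R;
  HCP : nat -> R;
  HSP_lo : nat -> R;
  HSP_hi : nat -> R;
  Tg : nat -> nat -> R;
  Tf : nat -> nat -> R;
  HP_lo : nat -> nat -> R;          (* interior pipe heads, 1 <= r < NP j *)
  HP_hi : nat -> nat -> R;
  fric : R -> R -> R -> R           (* f(T, Q, D), meaningful for T > 0 only *)
}.

Record pump_box := PumpBox {
  x_lo : nat -> int; x_hi : nat -> int;
  y_lo : nat -> int; y_hi : nat -> int
}.

(* The bounds modified by the algorithm; the interior pipe head bounds are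
   never modified and belong to [hop]. *)
Record bounds (R : realType) := Bounds {
  Hin_lo : nat -> R; Hin_hi : nat -> R;
  Tin_lo : nat -> R; Tin_hi : nat -> R;
  Hout_lo : nat -> R; Hout_hi : nat -> R;
  Tout_lo : nat -> R; Tout_hi : nat -> R
}.

Definition is_station (R : realType) (P : hop R) (j : nat) : Prop :=
  (1 <= j <= NS P)%N.
Definition is_pipe (R : realType) (P : hop R) (j : nat) : Prop :=
  (1 <= j < NS P)%N.
Definition is_segment (R : realType) (P : hop R) (j r : nat) : Prop :=
  is_pipe P j /\ (1 <= r <= NP P j)%N.

Definition fric_assumption (R : realType) (P : hop R) : Prop :=
  forall Q D : R, 0 < Q -> 0 < D ->
    convex_function (`]0, +oo[%classic : set R) (fun T : R => fric P T Q D) /\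
    (forall T1 T2 : R, 0 < T1 -> T1 < T2 -> fric P T2 Q D < fric P T1 Q D).

Definition hop_assumptions (R : realType) (P : hop R) : Prop :=
  [/\ (1 <= NS P)%N,
      [/\ 0 <= price_p P, 0 <= price_f P, 0 <= grav P &
          [/\ 0 < Vc P, 0 < rho P & 0 < heatcap P]],
      (forall j, is_pipe P j ->
         [/\ (1 <= NP P j)%N, 0 < flow P j 0%N,
             [/\ 0 < xiCP P j, 0 < xiSP P j & 0 < eta P j] &
             [/\ 0 <= HCP P j, 0 <= HSP_lo P j & HSP_lo P j <= HSP_hi P j]]),
      (forall j r, is_segment P j r ->
         [/\ [/\ 0 < flow P j r, 0 < din P j r & 0 <= dout P j r],
             0 <= len P j r, 0 <= htc P j r, 0 <= Tg P j r & 0 <= Tf P j r]) /\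
      (forall j r, is_pipe P j -> (1 <= r < NP P j)%N ->
         0 <= HP_lo P j r /\ 0 <= HP_hi P j r) &
      fric_assumption P].

(* x and y count pumps.  Only the nonnegativity of the upper bound of y is
   needed: y < 0 contradicts y * HSP_lo <= y * HSP_hi unless the two pump
   heads coincide, and the algorithm never tests this. *)
Definition pump_box_assumptions (R : realType) (P : hop R) (z : pump_box) :
    Prop :=
  forall j, is_pipe P j ->
    [/\ x_lo z j <= x_hi z j, y_lo z j <= y_hi z j & 0 <= y_hi z j].

Definition bounds_assumptions (R : realType) (P : hop R) (b : bounds R) : Prop :=
  [/\ (forall j, is_station P j ->
         [/\ 0 <= Hin_lo b j, 0 <= Hin_hi b j, 0 <= Tin_lo b j &
             0 <= Tin_hi b j]),
      (forall j, is_pipe P j ->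
         [/\ 0 <= Hout_lo b j, 0 <= Hout_hi b j, 0 <= Tout_lo b j &
             0 <= Tout_hi b j]),
      Hin_lo b 1%N = Hin_hi b 1%N &
      Tin_lo b 1%N = Tin_hi b 1%N].

Definition alpha (R : realType) (P : hop R) (j r : nat) : R :=
  htc P j r * pi * dout P j r / (rho P * flow P j r * heatcap P).

(* B_{jr} and e_{jr} *)
Definition ambient (R : realType) (P : hop R) (j r : nat) : R :=
  Tg P j r + Tf P j r.
Definition decay (R : realType) (P : hop R) (j r : nat) : R :=
  expR (- (alpha P j r * len P j r)).

Record scheme (R : realType) := Scheme {
  sx : nat -> R;
  sy : nat -> R;
  sDHSP : nat -> R;
  sDT : nat -> R;
  sHoutS : nat -> R;
  sToutS : nat -> R;
  sHinS : nat -> R;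
  sTinS : nat -> R;
  sHoutP : nat -> nat -> R;
  sToutP : nat -> nat -> R;
  sTave : nat -> nat -> R;
  sF : nat -> nat -> R
}.

(* s = (z, DeltaH^SP, DeltaT, H_out^S) with z = (x, y) *)
Record decision (R : realType) := Decision {
  vx : nat -> R;
  vy : nat -> R;
  vDHSP : nat -> R;
  vDT : nat -> R;
  vHoutS : nat -> R
}.

Definition decision_of (R : realType) (psi : scheme R) : decision R :=
  Decision (sx psi) (sy psi) (sDHSP psi) (sDT psi) (sHoutS psi).

Definition cost (R : realType) (P : hop R) (s : decision R) : R :=
  \sum_(1 <= j < NS P)
    (price_p P * rho P * flow P j 0%N * grav P *
       (vx s j * HCP P j / xiCP P j + vDHSP s j / xiSP P j) +
     price_f P * heatcap P * rho P * flow P j 0%N *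
       (vDT s j / (eta P j * Vc P))).

(* f is defined at positive temperatures only, so the friction law includes
   that its argument is positive. *)
Definition equality_constraints (R : realType) (P : hop R) (psi : scheme R) :
    Prop :=
  (forall j r, is_segment P j r ->
     [/\ sHoutP psi j r = sHoutP psi j r.-1 - sF psi j r - dZ P j r,
         0 < sTave psi j r /\
           sF psi j r =
             fric P (sTave psi j r) (flow P j r) (din P j r) * len P j r,
         sToutP psi j r =
           ambient P j r + (sToutP psi j r.-1 - ambient P j r) * decay P j r &
         sTave psi j r =
           1 / 3 * sToutP psi j r.-1 + 2 / 3 * sToutP psi j r]) /\
  (forall j, is_pipe P j ->
     [/\ sTinS psi j + sDT psi j = sToutS psi j,
         sToutP psi j 0%N = sToutS psi j,
         sToutP psi j (NP P j) = sTinS psi j.+1,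
         sHoutP psi j 0%N = sHoutS psi j &
         sHoutP psi j (NP P j) = sHinS psi j.+1]).

(* The given inlet values of station 1 are imposed through its inlet bounds,
   which coincide initially. *)
Definition inequality_constraints (R : realType) (P : hop R) (z : pump_box)
    (b : bounds R) (psi : scheme R) : Prop :=
  [/\ (forall j, is_pipe P j ->
         [/\ sHinS psi j + sx psi j * HCP P j + sDHSP psi j >= sHoutS psi j,
             sy psi j * HSP_lo P j <= sDHSP psi j <= sy psi j * HSP_hi P j,
             0 <= sDT psi j,
             (x_lo z j)%:~R <= sx psi j <= (x_hi z j)%:~R &
             (y_lo z j)%:~R <= sy psi j <= (y_hi z j)%:~R]),
      (forall j, is_station P j ->
         Hin_lo b j <= sHinS psi j <= Hin_hi b j /\
         Tin_lo b j <= sTinS psi j <= Tin_hi b j),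
      (forall j, is_pipe P j ->
         Hout_lo b j <= sHoutS psi j <= Hout_hi b j /\
         Tout_lo b j <= sToutS psi j <= Tout_hi b j) &
      (forall j r, is_pipe P j -> (1 <= r < NP P j)%N ->
         HP_lo P j r <= sHoutP psi j r <= HP_hi P j r)].

Definition is_scheme_of (R : realType) (P : hop R) (s : decision R)
    (psi : scheme R) : Prop :=
  decision_of psi = s /\ equality_constraints P psi.

Definition feasible_region (R : realType) (P : hop R) (z : pump_box)
    (b : bounds R) : set (decision R) :=
  [set s | exists psi : scheme R,
     is_scheme_of P s psi /\ inequality_constraints P z b psi].

(* At both ends of pipe j the head bounds are those of the adjacent stations. *)
Definition pipe_head_lo (R : realType) (P : hop R) (b : bounds R)
    (j r : nat) : R :=
  if r == 0%N then Hout_lo b j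
  else if r == NP P j then Hin_lo b j.+1 else HP_lo P j r.
Definition pipe_head_hi (R : realType) (P : hop R) (b : bounds R)
    (j r : nat) : R :=
  if r == 0%N then Hout_hi b j
  else if r == NP P j then Hin_hi b j.+1 else HP_hi P j r.

(* T_out^{P_jr} when T_out^{S_j} = u *)
Fixpoint pipe_temp (R : realType) (P : hop R) (j : nat) (u : R) (r : nat) : R :=
  if r is r'.+1 then
    ambient P j r + (pipe_temp P j u r' - ambient P j r) * decay P j r
  else u.

Definition pipe_tave (R : realType) (P : hop R) (j : nat) (u : R) (r : nat) : R :=
  1 / 3 * pipe_temp P j u r.-1 + 2 / 3 * pipe_temp P j u r.

Definition pipe_friction (R : realType) (P : hop R) (j : nat) (u : R) (r : nat) :
    R :=
  fric P (pipe_tave P j u r) (flow P j r) (din P j r) * len P j r.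

(* H_out^{P_jr} when T_out^{S_j} = u and H_out^{S_j} = h *)
Fixpoint pipe_head (R : realType) (P : hop R) (j : nat) (u h : R) (r : nat) : R :=
  if r is r'.+1 then
    pipe_head P j u h r' - pipe_friction P j u r - dZ P j r
  else h.

(* T_ave^{P_{j,r0+r}} = phi P j r0 r * T_out^{P_{j r0}} + psi_coef P j r0 r *)
Definition phi (R : realType) (P : hop R) (j r0 r : nat) : R :=
  1 / 3 * (1 + 2 * decay P j (r0 + r)) *
  \prod_(1 <= t < r) decay P j (r0 + t).

Definition psi_coef (R : realType) (P : hop R) (j r0 r : nat) : R :=
  1 / 3 * (1 + 2 * decay P j (r0 + r)) *
    (\sum_(1 <= t < r)
       ambient P j (r0 + t) * (1 - decay P j (r0 + t)) *
       \prod_(t.+1 <= k < r) decay P j (r0 + k)) +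
  2 / 3 * ambient P j (r0 + r) * (1 - decay P j (r0 + r)).

(* The value u of T_out^{P_{j r0}} for which the head falls from its lower bound
   at r0 to its upper bound at r1; all arguments of f must be in its domain. *)
Definition solves_head_equation (R : realType) (P : hop R) (b : bounds R)
    (j r0 r1 : nat) (u : R) : Prop :=
  (forall t, (1 <= t <= r1 - r0)%N ->
     0 < phi P j r0 t * u + psi_coef P j r0 t) /\
  pipe_head_hi P b j r1 =
    pipe_head_lo P b j r0 -
    \sum_(1 <= t < (r1 - r0).+1)
      (fric P (phi P j r0 t * u + psi_coef P j r0 t)
         (flow P j (r0 + t)) (din P j (r0 + t)) * len P j (r0 + t) +
       dZ P j (r0 + t)).

(* T_out^{S_j} recovered from T_out^{P_{j r0}} = u *)
Definition backward_temp (R : realType) (P : hop R) (j r0 : nat) (u : R) : R :=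
  \sum_(1 <= t < r0.+1)
    ambient P j t * (1 - expR (alpha P j t * len P j t)) *
    \prod_(1 <= k < t) expR (alpha P j k * len P j k) +
  (\prod_(1 <= t < r0.+1) expR (alpha P j t * len P j t)) * u.

Definition upd (R : realType) (h : nat -> R) (j : nat) (v : R) : nat -> R :=
  fun k => if k == j then v else h k.

(* Any shrinking of the four pairs of bounds is accepted, provided it keeps the
   feasible region and every remaining T_out^{S_j} gives an admissible
   T_in^{S_{j+1}}. *)
Definition domain_propagation (R : realType) (P : hop R) (z : pump_box)
    (j : nat) (b b' : bounds R) : Prop :=
  [/\ (exists hol hoh tol toh hil hih til tih : R,
         b' = Bounds
           (upd (Hin_lo b) j.+1 hil) (upd (Hin_hi b) j.+1 hih)
           (upd (Tin_lo b) j.+1 til) (upd (Tin_hi b) j.+1 tih)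
           (upd (Hout_lo b) j hol) (upd (Hout_hi b) j hoh)
           (upd (Tout_lo b) j tol) (upd (Tout_hi b) j toh) /\
         [/\ Hout_lo b j <= hol /\ hoh <= Hout_hi b j,
             Tout_lo b j <= tol /\ toh <= Tout_hi b j,
             Hin_lo b j.+1 <= hil /\ hih <= Hin_hi b j.+1 &
             Tin_lo b j.+1 <= til /\ tih <= Tin_hi b j.+1]),
      feasible_region P z b' = feasible_region P z b &
      (forall u : R, Tout_lo b' j <= u <= Tout_hi b' j ->
         Tin_lo b' j.+1 <= pipe_temp P j u (NP P j) <= Tin_hi b' j.+1)].

(* Heads along pipe j for the largest outlet temperature and the smallest outlet
   head; [shifted_head] adds deltaH = trial_gap P b j r0 to them. *)
Definition trial_head (R : realType) (P : hop R) (b : bounds R) (j r : nat) : R :=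
  pipe_head P j (Tout_hi b j) (Hout_lo b j) r.

Definition trial_gap (R : realType) (P : hop R) (b : bounds R) (j r : nat) : R :=
  pipe_head_lo P b j r - trial_head P b j r.

Definition shifted_head (R : realType) (P : hop R) (b : bounds R)
    (j r0 r : nat) : R :=
  trial_head P b j r + trial_gap P b j r0.

(* The heads can be computed, i.e. f is evaluated at positive temperatures only,
   and r0 maximizes the gap. *)
Definition trial (R : realType) (P : hop R) (b : bounds R) (j r0 : nat) : Prop :=
  [/\ (forall r, (1 <= r <= NP P j)%N -> 0 < pipe_tave P j (Tout_hi b j) r),
      (r0 <= NP P j)%N &
      (forall r, (r <= NP P j)%N -> trial_gap P b j r <= trial_gap P b j r0)].

Definition exceeds (R : realType) (P : hop R) (b : bounds R) (j r0 r1 : nat) :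
    Prop :=
  (r1 <= NP P j)%N /\ pipe_head_hi P b j r1 < shifted_head P b j r0 r1.

Definition lower_Tout (R : realType) (j : nat) (v : R) (b : bounds R) :
    bounds R :=
  Bounds (Hin_lo b) (Hin_hi b) (Tin_lo b) (Tin_hi b)
         (Hout_lo b) (Hout_hi b) (Tout_lo b) (upd (Tout_hi b) j v).

(* h is the shifted value of H_out^{S_j} *)
Definition tighten (R : realType) (P : hop R) (z : pump_box) (j : nat) (h : R)
    (b : bounds R) : bounds R :=
  Bounds
    (upd (Hin_lo b) j
       (Num.max (Hin_lo b j)
          (h - (x_hi z j)%:~R * HCP P j - (y_hi z j)%:~R * HSP_hi P j)))
    (Hin_hi b)
    (Tin_lo b)
    (upd (Tin_hi b) j (Num.min (Tin_hi b j) (Tout_hi b j)))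
    (upd (Hout_lo b) j h) (Hout_hi b)
    (Tout_lo b) (Tout_hi b).

Definition crossed (R : realType) (P : hop R) (b : bounds R) : Prop :=
  [\/ (exists j, is_station P j /\
         (Hin_hi b j < Hin_lo b j \/ Tin_hi b j < Tin_lo b j)),
      (exists j, is_pipe P j /\
         (Hout_hi b j < Hout_lo b j \/ Tout_hi b j < Tout_lo b j)) |
      (exists j r, [/\ is_pipe P j, (1 <= r < NP P j)%N &
         HP_hi P j r < HP_lo P j r])].

Inductive verdict := Feasible | Infeasible.

(* Control points of the algorithm: start of iteration j (j = 0: the loop is
   over), start of the trial computation on pipe j, consistency check of the
   bounds at the end of iteration j, and termination. *)
Inductive config (R : realType) :=
| Start of nat & bounds R
| Trial of nat & bounds R
| Check of nat & bounds R
| Return of verdict & bounds R.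

Definition bounds_of (R : realType) (c : config R) : bounds R :=
  match c with
  | Start _ b | Trial _ b | Check _ b | Return _ b => b
  end.

(* The propagated bounds, the maximizer r0 and the violating index r1 are
   arbitrary choices. *)
Inductive step (R : realType) (P : hop R) (z : pump_box) :
    config R -> config R -> Prop :=
| loop_end b :
    step P z (Start 0%N b) (Return Feasible b)
| propagate j b b' :
    (0 < j)%N -> domain_propagation P z j b b' ->
    step P z (Start j b) (Trial j b')
| exceeds_before j b r0 r1 :
    trial P b j r0 -> exceeds P b j r0 r1 -> (r1 < r0)%N ->
    step P z (Trial j b) (Return Infeasible b)
| exceeds_unsolvable j b r0 r1 :
    trial P b j r0 -> exceeds P b j r0 r1 -> (r0 <= r1)%N ->
    ~ (exists u, solves_head_equation P b j r0 r1 u) ->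
    step P z (Trial j b) (Return Infeasible b)
| exceeds_solvable j b r0 r1 u :
    trial P b j r0 -> exceeds P b j r0 r1 -> (r0 <= r1)%N ->
    solves_head_equation P b j r0 r1 u ->
    step P z (Trial j b)
             (Trial j (lower_Tout j (backward_temp P j r0 u) b))
| within j b r0 :
    trial P b j r0 -> ~ (exists r1, exceeds P b j r0 r1) ->
    step P z (Trial j b)
             (Check j (tighten P z j (shifted_head P b j r0 0%N) b))
| check_failed j b :
    crossed P b -> step P z (Check j b) (Return Infeasible b)
| check_passed j b :
    ~ crossed P b -> step P z (Check j b) (Start j.-1 b).

Definition reachable (R : realType) (P : hop R) (z : pump_box) (b0 : bounds R)
    (c : config R) : Prop :=
  clos_refl_trans (config R) (step P z) (Start (NS P).-1 b0) c.

(* Main.v *)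
(* Friction decreases with temperature.  Hence, on one pipe and among the schemes
   meeting a given lower head bound at r0, the largest outlet temperature gives
   the smallest heads before r0 and the largest heads after it.  If the heads
   computed at that temperature, touching their lower bound at r0, exceed an
   upper bound at r1 < r0, then every scheme does.  If they exceed it at
   r1 >= r0, every feasible scheme must be colder: convexity makes friction
   continuous, so by the intermediate value theorem a feasible scheme yields a
   solution of the head equation, and by strict monotonicity no feasible scheme
   is warmer than such a solution.  Once no head is exceeded, the largest
   temperature and the raised outlet head form an admissible profile of the pipe,
   and running all pumps at full capacity connects the profiles of consecutive
   pipes. *)

Require Import Defs.
From mathcomp Require Import all_boot all_order all_algebra.
From mathcomp Require Import all_classical all_reals all_analysis.
From mathcomp Require Import ring lra zify.

Set Implicit Arguments.
Unset Strict Implicit.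
Unset Printing Implicit Defensive.

Import Order.TTheory GRing.Theory Num.Theory numFieldNormedType.Exports.

(** * Continuity of convex decreasing functions on the positive half-line *)

Section ConvexDecreasing.
Local Open Scope ring_scope.
Local Open Scope classical_set_scope.
Variables (R : realType) (f : R -> R).
Hypothesis f_convex : convex_function (`]0, +oo[%classic : set R) f.
Hypothesis f_decr : forall a b : R, 0 < a -> a < b -> f b < f a.

Lemma decreasing_le (a b : R) : 0 < a -> a <= b -> f b <= f a.
Proof.
by move=> a0; rewrite le_eqVlt => /predU1P[->//|ab]; apply/ltW/f_decr.
Qed.

(** Convexity at [p], seen as the combination of [a] and [q] with weight [(q - p) / (q - a)] on [a],
    cleared of denominators. *)
Lemma convex_three_points (a p q : R) : 0 < a -> a < p -> p <= q ->
  f p * (q - a) <= f a * (q - p) + f q * (p - a).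
Proof.
move=> a0 ap pq; have aq : 0 < q - a by rewrite subr_gt0 (lt_le_trans ap).
have t01 : 0 <= (q - p) / (q - a) <= 1.
  rewrite ler_pdivrMr// mul1r; apply/andP; split; last by lra.
  by apply: divr_ge0; lra.
pose t : {i01 R} := Itv01 (andP t01).1 (andP t01).2.
have := @f_convex t a q; rewrite !inE/= !in_itv/= !andbT.
move=> /(_ a0 ltac:(lra)).
rewrite [X in f X <= _](_ : _ = p); last first.
  by rewrite [LHS](@convRE R a q t)/= /unstable.onem; field; rewrite gt_eqF.
rewrite convRE/= /unstable.onem.
move=> /(ler_wpM2r (ltW aq)) /le_trans; apply.
by rewrite le_eqVlt; apply/orP; left; apply/eqP; field; rewrite gt_eqF.
Qed.

(** A convex decreasing function flattens to the right, so chords in the window from [x / 2] to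
    [2 * x] are controlled from the anchor [x / 4], which stays at distance at least [x / 4] from
    the window. *)
Lemma convex_decreasing_lipschitz (x p q : R) : 0 < x ->
  x / 2 <= p -> p <= q -> q <= 2 * x ->
  f p - f q <= (f (x / 4) - f (2 * x)) / (x / 4) * (q - p).
Proof.
move=> x0 xp pq qx.
have := @convex_three_points (x / 4) p q ltac:(lra) ltac:(lra) pq => h.
have fq : f (2 * x) <= f q by apply: decreasing_le => //; lra.
have fpq : f q <= f p by apply: decreasing_le => //; lra.
rewrite mulrAC ler_pdivlMr; last by lra.
apply: (@le_trans _ _ ((f p - f q) * (q - x / 4))).
  by rewrite ler_wpM2l ?subr_ge0//; lra.
apply: (@le_trans _ _ ((f (x / 4) - f q) * (q - p))); first by lra.
by rewrite ler_wpM2r ?subr_ge0//; lra.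
Qed.

Lemma convex_decreasing_continuous (x : R) : 0 < x -> {for x, continuous f}.
Proof.
move=> x0; pose K := (f (x / 4) - f (2 * x)) / (x / 4).
have K0 : 0 <= K.
  apply: divr_ge0; last by lra.
  by rewrite subr_ge0 decreasing_le//; lra.
apply/cvgrPdist_le => /= e e0.
near=> y.
(* Dividing by [K + 1] avoids a separate case for [K = 0]. *)
have yd : `|x - y| <= e / (K + 1).
  by near: y; apply: cvgr_dist_le; [exact: cvg_id|rewrite divr_gt0//; lra].
have yx : `|x - y| <= x / 2.
  by near: y; apply: cvgr_dist_le; [exact: cvg_id|lra].
have {yx} [yx1 yx2] : x / 2 <= y /\ y <= 2 * x by move: yx; rewrite ler_norml; lra.
apply: (@le_trans _ _ (K * `|x - y|)); last first.
  apply: (@le_trans _ _ ((K + 1) * `|x - y|)).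
    by rewrite ler_wpM2r// lerDl.
  by rewrite mulrC -ler_pdivlMr//; lra.
have [xy|/ltW yx] := leP x y.
- rewrite [`|x - y|]distrC [`|y - x|]ger0_norm ?subr_ge0//.
  rewrite ger0_norm ?subr_ge0 ?decreasing_le//.
  by apply: convex_decreasing_lipschitz => //; lra.
- rewrite [`|x - y|]ger0_norm ?subr_ge0// distrC.
  rewrite ger0_norm ?subr_ge0 ?decreasing_le//; last by lra.
  by apply: convex_decreasing_lipschitz => //; lra.
Unshelve. all: by end_near. Qed.

End ConvexDecreasing.

(** * Temperature and head profiles along one pipe *)

Section Pipe.
Local Open Scope ring_scope.
Local Open Scope classical_set_scope.
Variables (R : realType) (P : hop R) (j : nat).

Lemma decay_gt0 (r : nat) : 0 < decay P j r.
Proof. exact: expR_gt0. Qed.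

Lemma pipe_temp_lt (u v : R) (r : nat) :
  u < v -> pipe_temp P j u r < pipe_temp P j v r.
Proof.
by move=> uv; elim: r => //= r IH; rewrite ltrD2l ltr_pM2r ?decay_gt0// ltrD2r.
Qed.

Lemma pipe_tave_lt (u v : R) (r : nat) :
  u < v -> pipe_tave P j u r < pipe_tave P j v r.
Proof.
move=> uv; rewrite /pipe_tave.
have := pipe_temp_lt r uv; have := pipe_temp_lt r.-1 uv; lra.
Qed.

Lemma pipe_tave_le (u v : R) (r : nat) :
  u <= v -> pipe_tave P j u r <= pipe_tave P j v r.
Proof. by rewrite le_eqVlt => /predU1P[->//|/(pipe_tave_lt r)/ltW]. Qed.

(** Unrolling of the affine temperature recurrence from segment [r0]; this is the source of the
    closed forms [phi] and [psi_coef]. *)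
Lemma pipe_temp_add (u : R) (r0 t : nat) :
  pipe_temp P j u (r0 + t) =
  pipe_temp P j u r0 * (\prod_(1 <= k < t.+1) decay P j (r0 + k)) +
  \sum_(1 <= s < t.+1) ambient P j (r0 + s) * (1 - decay P j (r0 + s)) *
    \prod_(s.+1 <= k < t.+1) decay P j (r0 + k).
Proof.
elim: t => [|t IH]; first by rewrite addn0 !big_geq// mulr1 addr0.
rewrite addnS /= IH -!addnS (@big_nat_recr _ _ _ t.+1)//=.
rewrite [X in _ = _ + X](@big_nat_recr _ _ _ t.+1)//= [\prod_(t.+2 <= _ < _) _]big_geq//.
under [X in _ = _ + (X + _)]eq_big_nat => s /andP[s1 st].
  by rewrite (@big_nat_recr _ _ _ t.+1)//= mulrA; over.
rewrite -mulr_suml; ring.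
Qed.

Lemma pipe_tave_add (u : R) (r0 t : nat) : (0 < t)%N ->
  pipe_tave P j u (r0 + t) =
  phi P j r0 t * pipe_temp P j u r0 + psi_coef P j r0 t.
Proof.
case: t => // t _.
rewrite /pipe_tave addnS /= pipe_temp_add /phi /psi_coef !addnS.
by field.
Qed.

(** Inverting the temperature law on the last segment pulls [u] back by one segment, which drives
    the induction of [backward_tempK]. *)
Lemma backward_temp_rec (u : R) (r : nat) :
  backward_temp P j r.+1 u =
  backward_temp P j r (ambient P j r.+1 + (u - ambient P j r.+1) *
                         expR (alpha P j r.+1 * len P j r.+1)).
Proof.
rewrite /backward_temp !(@big_nat_recr _ _ _ r.+1)//=.
ring.
Qed.

Lemma backward_tempK (u : R) (r : nat) :
  pipe_temp P j (backward_temp P j r u) r = u.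
Proof.
elim: r u => [|r IH] u; first by rewrite /backward_temp /= !big_geq// mul1r add0r.
rewrite backward_temp_rec /= IH /decay expRN.
by field; rewrite gt_eqF ?expR_gt0.
Qed.

(** It does not involve the outlet head, so comparing two schemes between fixed points of a pipe
    amounts to comparing their drops. *)
Definition head_drop (u : R) (a b : nat) : R :=
  \sum_(a <= r < b) (pipe_friction P j u r.+1 + dZ P j r.+1).

Lemma pipe_headE (u h : R) (a b : nat) : (a <= b)%N ->
  pipe_head P j u h b = pipe_head P j u h a - head_drop u a b.
Proof.
rewrite /head_drop; elim: b => [|b IH].
  by rewrite leqn0 => /eqP->; rewrite big_geq// subr0.
rewrite leq_eqVlt => /predU1P[->|]; first by rewrite big_geq// subr0.
by rewrite ltnS => ab; rewrite big_nat_recr//= IH//; ring.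
Qed.

(** Restates the head equation, whose unknown is the temperature at [r0], in terms of the station
    outlet temperature [v]. By [backward_tempK] every unknown arises from some [v]. *)
Lemma solves_head_equationE (b : bounds R) (r0 r1 : nat) (v : R) :
  (r0 <= r1)%N ->
  solves_head_equation P b j r0 r1 (pipe_temp P j v r0) <->
  (forall r, (r0 < r <= r1)%N -> 0 < pipe_tave P j v r) /\
  pipe_head_hi P b j r1 = pipe_head_lo P b j r0 - head_drop v r0 r1.
Proof.
move=> r01.
have -> : head_drop v r0 r1 = \sum_(1 <= t < (r1 - r0).+1)
    (fric P (phi P j r0 t * pipe_temp P j v r0 + psi_coef P j r0 t)
         (flow P j (r0 + t)) (din P j (r0 + t)) * len P j (r0 + t) +
       dZ P j (r0 + t)).
  rewrite /head_drop -{1}(add0n r0) big_addn big_add1 /=.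
  by apply: eq_bigr => t _; rewrite -pipe_tave_add// addnS addnC.
split=> -[pos eqn]; split=> //.
  move=> r /andP[r0r rr1].
  by rewrite -(subnKC (ltnW r0r)) pipe_tave_add ?subn_gt0//; apply: pos; lia.
by move=> t /andP[t0 tr]; rewrite -pipe_tave_add//; apply: pos; lia.
Qed.

Hypotheses (hP : hop_assumptions P) (hj : is_pipe P j).

Lemma segment_flow_din_len (r : nat) : (0 < r <= NP P j)%N ->
  [/\ 0 < flow P j r, 0 < din P j r & 0 <= len P j r].
Proof.
by case: hP => _ _ _ [h _] _ hr; case: (h j r (conj hj hr)) => -[].
Qed.

Lemma pipe_friction_le (u v : R) (r : nat) : (0 < r <= NP P j)%N ->
  0 < pipe_tave P j u r -> u <= v ->
  pipe_friction P j v r <= pipe_friction P j u r.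
Proof.
move=> hr u0 uv; have [Q0 D0 L0] := segment_flow_din_len hr.
case: hP => _ _ _ _ /(_ _ _ Q0 D0)[_ fdec].
rewrite /pipe_friction ler_wpM2r//.
by apply: (decreasing_le fdec) => //; exact: pipe_tave_le.
Qed.

Lemma pipe_friction_continuous (u : R) (r : nat) : (0 < r <= NP P j)%N ->
  0 < pipe_tave P j u r -> {for u, continuous (fun v => pipe_friction P j v r)}.
Proof.
move=> hr u0; have [Q0 D0 L0] := segment_flow_din_len hr.
case: hP => _ _ _ _ /(_ _ _ Q0 D0)[fcvx fdec].
have ct s : {for u, continuous (fun v => pipe_temp P j v s)}.
  elim: s => [|s IH] /=; first exact: cvg_id.
  apply: cvgD; first exact: cvg_cst.
  apply: cvgM; last exact: cvg_cst.
  by apply: cvgB; [exact: IH|exact: cvg_cst].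
have ca : {for u, continuous (fun v => pipe_tave P j v r)}.
  by apply: cvgD; (apply: cvgM; [exact: cvg_cst|exact: ct]).
apply: cvgM; last exact: cvg_cst.
exact: (continuous_comp ca (convex_decreasing_continuous fcvx fdec u0)).
Qed.

Lemma head_drop_le (u v : R) (a b : nat) : (b <= NP P j)%N ->
  (forall r, (a < r <= b)%N -> 0 < pipe_tave P j u r) -> u <= v ->
  head_drop v a b <= head_drop u a b.
Proof.
move=> hb pos uv; apply: ler_sum_nat => r /andP[ar rb].
by rewrite lerD2r pipe_friction_le//; [lia|apply: pos; lia].
Qed.

(* A segment of length 0 makes the friction constant in u; the last hypothesis
   excludes that all segments have length 0. *)
Lemma head_drop_lt (u v w : R) (a b : nat) : (b <= NP P j)%N ->
  (forall r, (a < r <= b)%N -> 0 < pipe_tave P j u r) -> u < v ->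
  head_drop w a b != head_drop u a b ->
  head_drop v a b < head_drop u a b.
Proof.
move=> hb pos uv dwu; rewrite lt_neqAle head_drop_le ?(ltW uv)// andbT.
apply: contra dwu => /eqP; rewrite /head_drop => dvu.
have tle r : (a <= r < b)%N -> pipe_friction P j v r.+1 + dZ P j r.+1 <=
    pipe_friction P j u r.+1 + dZ P j r.+1.
  move=> /andP[ar rb]; rewrite lerD2r pipe_friction_le ?(ltW uv)//; first by lia.
  by apply: pos; lia.
apply/eqP/eq_big_nat => r /andP[ar rb].
(* The sums at [u] and [v] agree although each term at [v] is at most the one at [u]. A segment of
   positive length would make its term strictly smaller, so all lengths vanish and the temperature
   is immaterial. *)
have [l0|ln0] := eqVneq (len P j r.+1) 0.
  by rewrite /pipe_friction l0 !mulr0.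
exfalso; move: dvu; apply/eqP; rewrite lt_eqF//.
rewrite (@big_cat_nat _ _ _ r)/= ?(ltnW rb)// [ltRHS](@big_cat_nat _ _ _ r)/= ?(ltnW rb)//.
rewrite (@big_ltn _ _ _ r)// [X in _ < _ + X]big_ltn//.
apply: ler_ltD; first by apply: ler_sum_nat => s hs; apply: tle; lia.
apply: ltr_leD; last by apply: ler_sum_nat => s hs; apply: tle; lia.
rewrite ltrD2r /pipe_friction.
have [Q0 D0 L0] := @segment_flow_din_len r.+1 ltac:(lia).
case: hP => _ _ _ _ /(_ _ _ Q0 D0)[_ fdec].
rewrite ltr_pM2r; first by apply: fdec; [apply: pos; lia|exact: pipe_tave_lt].
by rewrite lt_neqAle eq_sym ln0.
Qed.

Lemma head_drop_continuous (u : R) (a b : nat) : (b <= NP P j)%N ->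
  (forall r, (a < r <= b)%N -> 0 < pipe_tave P j u r) ->
  {for u, continuous (fun v => head_drop v a b)}.
Proof.
elim: b => [|b IH] hb pos.
  rewrite (_ : (fun v => _) = cst 0); first exact: cvg_cst.
  by apply/funext => v; rewrite /head_drop big_geq.
have [ba|ab] := ltnP b a.
  rewrite (_ : (fun v => _) = cst 0); first exact: cvg_cst.
  by apply/funext => v; rewrite /head_drop big_geq.
rewrite (_ : (fun v => _) = (fun v =>
    head_drop v a b + (pipe_friction P j v b.+1 + dZ P j b.+1))); last first.
  by apply/funext => v; rewrite /head_drop big_nat_recr.
apply: cvgD.
  by apply: IH => [|r /andP[ar rb]]; [exact: ltnW|apply: pos; lia].
apply: cvgD; last exact: cvg_cst.
by apply: pipe_friction_continuous => //; apply: pos; lia.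
Qed.

(** Average temperatures grow with the outlet temperature, so positivity at [u] gives continuity on
    the whole interval. The bound [u <= w] lets the solution inherit positivity as well. *)
Lemma head_drop_ivt (u v y : R) (a b : nat) : (b <= NP P j)%N ->
  (forall r, (a < r <= b)%N -> 0 < pipe_tave P j u r) -> u <= v ->
  head_drop v a b <= y <= head_drop u a b ->
  exists2 w, u <= w & head_drop w a b = y.
Proof.
move=> hb pos uv /andP[vy yu].
have cont : {within `[u, v], continuous (fun w => head_drop w a b)}.
  apply: continuous_in_subspaceT => x; rewrite inE/= in_itv/= => /andP[ux xv].
  apply: head_drop_continuous => // r hr.
  exact: lt_le_trans (pos _ hr) (pipe_tave_le _ ux).
have [|w] := @IVT R _ _ _ y uv cont.
  by rewrite ge_min le_max vy yu orbT.
by rewrite in_itv/= => /andP[uw _] wy; exists w.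
Qed.

End Pipe.

(** * Effect of each step of the algorithm on the feasible region *)

Section FeasibleRegion.
Local Open Scope ring_scope.
Local Open Scope classical_set_scope.
Variables (R : realType) (P : hop R) (z : pump_box).
Hypothesis hP : hop_assumptions P.

Lemma NP_gt0 (j : nat) : is_pipe P j -> (0 < NP P j)%N.
Proof. by case: hP => _ _ h _ _ /h[]. Qed.

Lemma pump_heads (j : nat) : is_pipe P j ->
  [/\ 0 <= HCP P j, 0 <= HSP_hi P j & HSP_lo P j <= HSP_hi P j].
Proof.
by case: hP => _ _ h _ _ /h[_ _ _ [? lo0 le_hi]]; split=> //; exact: le_trans le_hi.
Qed.

Section Scheme.
Variables (psi : scheme R) (j : nat).
Hypotheses (eq_psi : equality_constraints P psi) (hj : is_pipe P j).

(** Along a pipe the equality constraints leave only [sToutS] and [sHoutS] free; this lemma and the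
    next ones replace a scheme by the recursive profiles. *)
Lemma scheme_temp (r : nat) : (r <= NP P j)%N ->
  sToutP psi j r = pipe_temp P j (sToutS psi j) r.
Proof.
case: eq_psi => /(_ j) seg /(_ _ hj)[_ T0 _ _ _].
elim: r => [|r IH] hr //=; have [_ _ -> _] := seg r.+1 (conj hj hr).
by rewrite -IH // ltnW.
Qed.

Lemma scheme_tave (r : nat) : (0 < r <= NP P j)%N ->
  sTave psi j r = pipe_tave P j (sToutS psi j) r.
Proof.
move=> hr; have [_ _ _ ->] := eq_psi.1 j r (conj hj hr).
by rewrite !scheme_temp//; lia.
Qed.

Lemma scheme_tave_gt0 (r : nat) : (0 < r <= NP P j)%N ->
  0 < pipe_tave P j (sToutS psi j) r.
Proof.
by move=> hr; rewrite -scheme_tave//; have [_ []] := eq_psi.1 j r (conj hj hr).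
Qed.

Lemma scheme_head (r : nat) : (r <= NP P j)%N ->
  sHoutP psi j r = pipe_head P j (sToutS psi j) (sHoutS psi j) r.
Proof.
have [_ _ _ H0 _] := eq_psi.2 j hj.
elim: r => [|r IH] hr //=; have [-> [_ ->] _ _] := eq_psi.1 j r.+1 (conj hj hr).
by rewrite /= IH ?(ltnW hr)// scheme_tave.
Qed.

Variable b : bounds R.
Hypothesis ineq_psi : inequality_constraints P z b psi.

Lemma scheme_head_bounds (r : nat) : (r <= NP P j)%N ->
  pipe_head_lo P b j r <= pipe_head P j (sToutS psi j) (sHoutS psi j) r
    <= pipe_head_hi P b j r.
Proof.
move=> hr; rewrite -scheme_head// /pipe_head_lo /pipe_head_hi.
have [_ _ _ H0 HN] := eq_psi.2 j hj; case: ineq_psi => _ hst hpi hin.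
have [->|r0] := eqVneq r 0%N; first by rewrite H0; case: (hpi j hj).
have [->|rN] := eqVneq r (NP P j); last by apply: hin => //; lia.
have js : is_station P j.+1 by move: hj; rewrite /is_pipe /is_station; lia.
by rewrite HN; case: (hst _ js).
Qed.

Lemma scheme_Tout_le : sToutS psi j <= Tout_hi b j.
Proof. by case: ineq_psi => _ _ /(_ j hj)[_ /andP[]]. Qed.

Lemma scheme_head_drop (a c : nat) : (a <= c <= NP P j)%N ->
  pipe_head_lo P b j a - pipe_head_hi P b j c <=
    head_drop P j (sToutS psi j) a c.
Proof.
move=> /andP[ac cN]; have := pipe_headE P j (sToutS psi j) (sHoutS psi j) ac.
have /andP[_ +] := scheme_head_bounds cN.
have /andP[+ _] := scheme_head_bounds (leq_trans ac cN).
lra.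
Qed.

End Scheme.

Lemma shifted_headE (b : bounds R) (j r0 r : nat) : (r0 <= r)%N ->
  shifted_head P b j r0 r =
  pipe_head_lo P b j r0 - head_drop P j (Tout_hi b j) r0 r.
Proof.
by move=> r0r; rewrite /shifted_head /trial_gap /trial_head (pipe_headE _ _ _ _ r0r); ring.
Qed.

Lemma shifted_head_beforeE (b : bounds R) (j r0 r : nat) : (r <= r0)%N ->
  shifted_head P b j r0 r =
  pipe_head_lo P b j r0 + head_drop P j (Tout_hi b j) r r0.
Proof.
by move=> rr0; rewrite /shifted_head /trial_gap /trial_head (pipe_headE _ _ _ _ rr0); ring.
Qed.

(** At [r0] a feasible head is at least the lower bound that the shifted profile touches. The scheme
    is no warmer than [Tout_hi b j], hence loses at least as much head between [r] and [r0]. *)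
Lemma scheme_head_ge_shifted (b : bounds R) (psi : scheme R) (j r0 r : nat) :
  equality_constraints P psi -> inequality_constraints P z b psi ->
  is_pipe P j -> (r <= r0 <= NP P j)%N ->
  shifted_head P b j r0 r <= pipe_head P j (sToutS psi j) (sHoutS psi j) r.
Proof.
move=> eq_psi ineq_psi hj /andP[rr0 r0N]; rewrite shifted_head_beforeE//.
have /andP[+ _] := scheme_head_bounds eq_psi hj ineq_psi r0N.
rewrite (pipe_headE _ _ _ _ rr0).
suff : head_drop P j (Tout_hi b j) r r0 <= head_drop P j (sToutS psi j) r r0 by lra.
apply: head_drop_le => //; last exact: scheme_Tout_le ineq_psi.
by move=> s hs; apply: scheme_tave_gt0 => //; lia.
Qed.

Lemma feasible_region_eq0 (b : bounds R) :
  (forall psi, equality_constraints P psi -> ~ inequality_constraints P z b psi) ->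
  feasible_region P z b = set0.
Proof.
by move=> h; rewrite -subset0 => s [psi [[_ eq_psi]]]; exact: h.
Qed.

Lemma feasible_region_eq (b b' : bounds R) :
  (forall psi, equality_constraints P psi ->
    inequality_constraints P z b psi <-> inequality_constraints P z b' psi) ->
  feasible_region P z b = feasible_region P z b'.
Proof.
move=> h; apply/seteqP; split=> s [psi [[sE eq_psi] ineq]];
  by exists psi; split=> //; apply/(h _ eq_psi).
Qed.

Definition bounds_le (b b' : bounds R) : Prop := forall k,
  [/\ Hin_lo b k <= Hin_lo b' k /\ Hin_hi b' k <= Hin_hi b k,
      Tin_lo b k <= Tin_lo b' k /\ Tin_hi b' k <= Tin_hi b k,
      Hout_lo b k <= Hout_lo b' k /\ Hout_hi b' k <= Hout_hi b k &
      Tout_lo b k <= Tout_lo b' k /\ Tout_hi b' k <= Tout_hi b k].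

Lemma bounds_le_trans (b c d : bounds R) :
  bounds_le b c -> bounds_le c d -> bounds_le b d.
Proof.
move=> bc cd k; have [[? ?] [? ?] [? ?] [? ?]] := bc k.
by have [[? ?] [? ?] [? ?] [? ?]] := cd k; split; split; lra.
Qed.

Lemma inequality_constraints_le (b b' : bounds R) (psi : scheme R) :
  bounds_le b b' ->
  inequality_constraints P z b' psi -> inequality_constraints P z b psi.
Proof.
move=> le_b [h1 h2 h3 h4]; split=> // k hk.
  have [[? ?] [? ?] _ _] := le_b k.
  by have [/andP[? ?] /andP[? ?]] := h2 k hk; split; apply/andP; split; lra.
have [_ _ [? ?] [? ?]] := le_b k.
by have [/andP[? ?] /andP[? ?]] := h3 k hk; split; apply/andP; split; lra.
Qed.

Lemma exceeds_before_infeasible (b : bounds R) (j r0 r1 : nat) :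
  is_pipe P j -> trial P b j r0 -> exceeds P b j r0 r1 -> (r1 < r0)%N ->
  feasible_region P z b = set0.
Proof.
move=> hj [_ r0N _] [r1N ex] r10; apply: feasible_region_eq0 => psi eqp ineqp.
have h : (r1 <= r0 <= NP P j)%N by lia.
have := scheme_head_ge_shifted eqp ineqp hj h.
by have /andP[_] := scheme_head_bounds eqp hj ineqp r1N; lra.
Qed.

Lemma exceeds_unsolvable_infeasible (b : bounds R) (j r0 r1 : nat) :
  is_pipe P j -> exceeds P b j r0 r1 -> (r0 <= r1)%N ->
  ~ (exists u, solves_head_equation P b j r0 r1 u) ->
  feasible_region P z b = set0.
Proof.
move=> hj [r1N ex] r01 unsolv; apply: feasible_region_eq0 => psi eqp ineqp.
apply: unsolv; rewrite shifted_headE// in ex.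
have pos r : (r0 < r <= r1)%N -> 0 < pipe_tave P j (sToutS psi j) r.
  by move=> hr; apply: scheme_tave_gt0 => //; lia.
have h : (r0 <= r1 <= NP P j)%N by rewrite r01.
have drop := scheme_head_drop eqp hj ineqp h.
(* The required drop is above the drop at [Tout_hi b j], because [r1] is exceeded, and at most the
   drop of the feasible scheme. *)
have [|w uw wE] := @head_drop_ivt R P j hP hj _ _
  (pipe_head_lo P b j r0 - pipe_head_hi P b j r1) _ _ r1N pos
  (scheme_Tout_le hj ineqp).
  by apply/andP; split; lra.
exists (pipe_temp P j w r0); apply/solves_head_equationE => //; split; last by lra.
by move=> r /pos /lt_le_trans; apply; exact: pipe_tave_le.
Qed.

(** A solution at or above [Tout_hi b j] would drop no more head than [Tout_hi b j] does, which is
    too little since [r1] is exceeded. *)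
Lemma backward_temp_lt_Tout_hi (b : bounds R) (j r0 r1 : nat) (u : R) :
  is_pipe P j -> trial P b j r0 -> exceeds P b j r0 r1 -> (r0 <= r1)%N ->
  solves_head_equation P b j r0 r1 u ->
  backward_temp P j r0 u < Tout_hi b j.
Proof.
rewrite -{1}(backward_tempK P j u r0); set v := backward_temp P j r0 u.
move=> hj [pos _ _] [r1N ex] r01 /(solves_head_equationE _ _ _ _ r01)[_ eqn].
rewrite ltNge; apply/negP => le_v; rewrite shifted_headE// in ex.
suff : head_drop P j v r0 r1 <= head_drop P j (Tout_hi b j) r0 r1 by lra.
by apply: head_drop_le => // r hr; apply: pos; lia.
Qed.

Lemma lower_Tout_le (b : bounds R) (j : nat) (v : R) :
  v <= Tout_hi b j -> bounds_le b (lower_Tout j v b).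
Proof.
by move=> hv k; split=> //=; split=> //; rewrite /upd; case: eqP => [->|].
Qed.

Lemma lower_Tout_region (b : bounds R) (j r0 r1 : nat) (u : R) :
  is_pipe P j -> trial P b j r0 -> exceeds P b j r0 r1 -> (r0 <= r1)%N ->
  solves_head_equation P b j r0 r1 u ->
  feasible_region P z (lower_Tout j (backward_temp P j r0 u) b) =
  feasible_region P z b.
Proof.
move=> hj tr ex r01 sol; have lt_v := backward_temp_lt_Tout_hi hj tr ex r01 sol.
apply: feasible_region_eq => psi eqp; split.
  exact/inequality_constraints_le/lower_Tout_le/ltW.
move=> ineqp; case: (ineqp) => h1 h2 h3 h4; split=> // k hk; have [? /andP[? ?]] := h3 k hk.
split=> //=; rewrite /upd; case: eqP => [kj|_]; last by apply/andP.
apply/andP; split=> //; subst k; rewrite leNgt; apply/negP => lt_psi.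
move: sol lt_v lt_psi; rewrite -{1}(backward_tempK P j u r0).
set v := backward_temp P j r0 u => /(solves_head_equationE _ _ _ _ r01)[pos eqn] lt_v lt_psi.
have h : (r0 <= r1 <= NP P j)%N by rewrite r01; case: ex.
have := scheme_head_drop eqp hj ineqp h.
case: ex => r1N; rewrite shifted_headE// => ex.
(* A scheme warmer than [v] would drop strictly less than its bounds require. The strictness is
   witnessed by [Tout_hi b j], where the drop already differs from that at [v]. *)
have := @head_drop_lt R P j hP hj v (sToutS psi j) (Tout_hi b j) r0 r1 r1N pos lt_psi.
by rewrite lt_eqF; [move=> /(_ isT); lra|lra].
Qed.

(** The gap at index 0 is zero, so the maximal gap is nonnegative. *)
Lemma trial_shift_ge (b : bounds R) (j r0 : nat) :
  trial P b j r0 -> Hout_lo b j <= shifted_head P b j r0 0.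
Proof.
case=> _ _ /(_ 0%N (leq0n _)).
by rewrite /shifted_head /trial_gap /trial_head /pipe_head_lo /=; lra.
Qed.

Lemma tighten_le (b : bounds R) (j : nat) (h : R) :
  Hout_lo b j <= h -> bounds_le b (tighten P z j h b).
Proof.
move=> hh k; split; split=> //=; rewrite /upd; case: eqP => [->|] //.
  by rewrite le_max lexx.
by rewrite ge_min lexx.
Qed.

(** Feasible outlet heads lie above the shifted one; full pumping bounds what a station can add to
    its inlet head, and heating never lowers the temperature. *)
Lemma tighten_region (b : bounds R) (j r0 : nat) :
  is_pipe P j -> trial P b j r0 ->
  feasible_region P z (tighten P z j (shifted_head P b j r0 0) b) =
  feasible_region P z b.
Proof.
move=> hj tr; apply: feasible_region_eq => psi eqp; split.
  exact/inequality_constraints_le/tighten_le/trial_shift_ge.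
move=> ineqp; case: (ineqp) => h1 h2 h3 h4.
have h0 : (0 <= r0 <= NP P j)%N by case: tr.
have /= le_out := scheme_head_ge_shifted eqp ineqp hj h0.
have [pump /andP[_ DH] DT /andP[_ xhi] /andP[_ yhi]] := h1 j hj.
have [HCP0 HSP0 _] := pump_heads hj.
have xH := ler_wpM2r HCP0 xhi; have yH := ler_wpM2r HSP0 yhi.
split=> // k hk.
  have [/andP[? ?] /andP[? ?]] := h2 k hk; rewrite /= /upd.
  have [kj|_] := eqVneq k j; last by split; apply/andP.
  subst k; split; apply/andP; split=> //.
    by rewrite ge_max; apply/andP; split=> //; lra.
  have [DTE _ _ _ _] := eqp.2 j hj; have := scheme_Tout_le hj ineqp.
  by rewrite le_min; move=> ?; apply/andP; split=> //; lra.
have [/andP[? ?] ?] := h3 k hk; split=> //=; rewrite /upd.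
by have [kj|_] := eqVneq k j; [subst k|]; apply/andP.
Qed.

Lemma crossed_infeasible (b : bounds R) :
  crossed P b -> feasible_region P z b = set0.
Proof.
move=> cr; apply: feasible_region_eq0 => psi _ [_ h2 h3 h4].
case: cr => [[k [hk lt_k]]|[k [hk lt_k]]|[k [r [hk hr lt_r]]]].
- by have [/andP[? ?] /andP[? ?]] := h2 k hk; case: lt_k; lra.
- by have [/andP[? ?] /andP[? ?]] := h3 k hk; case: lt_k; lra.
- by have /andP[? ?] := h4 k r hk hr; lra.
Qed.

End FeasibleRegion.

(** * Loop invariant and the scheme built from the final bounds *)

Section Invariant.
Local Open Scope ring_scope.
Local Open Scope classical_set_scope.
Variables (R : realType) (P : hop R) (z : pump_box) (b0 : bounds R).
Hypotheses (hP : hop_assumptions P) (hz : pump_box_assumptions P z).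

(* With T_out^{S_k} and H_out^{S_k} at their upper and lower bounds, pipe k
   meets its own constraints, and the other inlet bounds of station k are
   compatible with them. *)
Definition pipe_settled (b : bounds R) (k : nat) : Prop :=
  [/\ (forall r, (0 < r <= NP P k)%N -> 0 < pipe_tave P k (Tout_hi b k) r),
      (forall r, (r <= NP P k)%N ->
         pipe_head_lo P b k r <= trial_head P b k r <= pipe_head_hi P b k r),
      Hout_lo b k - (x_hi z k)%:~R * HCP P k - (y_hi z k)%:~R * HSP_hi P k
         <= Hin_lo b k /\ Tin_hi b k <= Tout_hi b k,
      Tout_lo b k <= Tout_hi b k &
      Tin_lo b k.+1 <= pipe_temp P k (Tout_hi b k) (NP P k) <= Tin_hi b k.+1].

Definition propagated (b : bounds R) (j : nat) : Prop :=
  forall u : R, Tout_lo b j <= u <= Tout_hi b j ->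
    Tin_lo b j.+1 <= pipe_temp P j u (NP P j) <= Tin_hi b j.+1.

Definition settled_after (b : bounds R) (j : nat) : Prop :=
  forall k, is_pipe P k -> (j < k)%N -> pipe_settled b k.

(** In the [Check] case the pipe is settled only conditionally, because [propagated] is void on an
    empty temperature interval and the crossing test is still to come. Station 1 ends no pipe, so
    the consistency of its inlet bounds is recorded separately. *)
Definition config_invariant (c : config R) : Prop :=
  match c with
  | Start j b =>
      [/\ (j <= (NS P).-1)%N, settled_after b j &
          j = 0%N -> Hin_lo b 1 <= Hin_hi b 1 /\ Tin_lo b 1 <= Tin_hi b 1]
  | Trial j b => [/\ is_pipe P j, settled_after b j & propagated b j]
  | Check j b =>
      [/\ is_pipe P j, settled_after b j &
          Tout_lo b j <= Tout_hi b j -> pipe_settled b j]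
  | Return Feasible b =>
      settled_after b 0 /\
      (Hin_lo b 1 <= Hin_hi b 1 /\ Tin_lo b 1 <= Tin_hi b 1)
  | Return Infeasible b => feasible_region P z b = set0
  end.

Definition invariant (c : config R) : Prop :=
  [/\ bounds_le b0 (bounds_of c),
      feasible_region P z (bounds_of c) = feasible_region P z b0 &
      config_invariant c].

(** Only the inlet bounds of station [k] itself may move, and the two conditions on them survive
    tightening. *)
Lemma pipe_settled_le (b b' : bounds R) (k : nat) :
  bounds_le b b' ->
  [/\ Hout_lo b' k = Hout_lo b k, Hout_hi b' k = Hout_hi b k,
      Tout_lo b' k = Tout_lo b k & Tout_hi b' k = Tout_hi b k] ->
  [/\ Hin_lo b' k.+1 = Hin_lo b k.+1, Hin_hi b' k.+1 = Hin_hi b k.+1,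
      Tin_lo b' k.+1 = Tin_lo b k.+1 & Tin_hi b' k.+1 = Tin_hi b k.+1] ->
  pipe_settled b k -> pipe_settled b' k.
Proof.
move=> /(_ k)[[leHl _] [_ leTh] _ _] [E1 E2 E3 E4] [E5 E6 E7 E8].
rewrite /pipe_settled /pipe_head_lo /pipe_head_hi /trial_head E1 E2 E3 E4 E5 E6 E7 E8.
move=> [? ? [? ?] ? ?]; split=> //; split.
  exact: le_trans leHl.
exact: le_trans leTh _.
Qed.

Lemma settled_after_upd (b b' : bounds R) (j : nat) :
  bounds_le b b' ->
  (forall k, (j < k)%N ->
     [/\ Hout_lo b' k = Hout_lo b k, Hout_hi b' k = Hout_hi b k,
         Tout_lo b' k = Tout_lo b k & Tout_hi b' k = Tout_hi b k]) ->
  (forall k, (j.+1 < k)%N ->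
     [/\ Hin_lo b' k = Hin_lo b k, Hin_hi b' k = Hin_hi b k,
         Tin_lo b' k = Tin_lo b k & Tin_hi b' k = Tin_hi b k]) ->
  settled_after b j -> settled_after b' j.
Proof.
move=> le_b out inn sa k hk jk.
by apply: (pipe_settled_le le_b (out k jk)) (sa k hk jk); apply: inn.
Qed.

Lemma upd_neq (h : nat -> R) (j k : nat) (v : R) : k != j -> upd h j v k = h k.
Proof. by rewrite /upd => /negPf->. Qed.

Lemma upd_eq (h : nat -> R) (j : nat) (v : R) : upd h j v j = v.
Proof. by rewrite /upd eqxx. Qed.

Lemma domain_propagation_le (j : nat) (b b' : bounds R) :
  domain_propagation P z j b b' -> bounds_le b b'.
Proof.
case=> -[? [? [? [? [? [? [? [? [-> [[? ?] [? ?] [? ?] [? ?]]]]]]]]]]] _ _ k.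
by split=> /=; split; rewrite /upd; case: eqP => // ->.
Qed.

Lemma domain_propagation_settled (j : nat) (b b' : bounds R) :
  domain_propagation P z j b b' -> settled_after b j -> settled_after b' j.
Proof.
move=> dp; apply: settled_after_upd; first exact: domain_propagation_le dp.
  case: dp => -[? [? [? [? [? [? [? [? [-> _]]]]]]]]] _ _ k jk.
  by split; rewrite /= upd_neq// gtn_eqF.
case: dp => -[? [? [? [? [? [? [? [? [-> _]]]]]]]]] _ _ k jk.
by split; rewrite /= upd_neq// gtn_eqF.
Qed.

Lemma lower_Tout_propagated (b : bounds R) (j : nat) (v : R) :
  v <= Tout_hi b j -> propagated b j -> propagated (lower_Tout j v b) j.
Proof.
move=> hv pr u /=; rewrite upd_eq => /andP[lu uv]; apply: pr.
by rewrite lu (le_trans uv).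
Qed.

Lemma within_settled (b : bounds R) (j r0 : nat) (h := shifted_head P b j r0 0) :
  is_pipe P j -> trial P b j r0 -> ~ (exists r1, exceeds P b j r0 r1) ->
  propagated b j -> Tout_lo b j <= Tout_hi b j ->
  pipe_settled (tighten P z j h b) j.
Proof.
move=> hj [pos r0N maxr] noex pr Tle.
have NP0 := NP_gt0 hP hj.
have jS : j.+1 != j by rewrite neq_ltn ltnSn orbT.
(* Raising the outlet head translates the whole profile. *)
have headE r : trial_head P (tighten P z j h b) j r = shifted_head P b j r0 r.
  rewrite /trial_head /= upd_eq (pipe_headE _ _ _ _ (leq0n r)) /=.
  by rewrite /h /shifted_head /trial_head [in RHS](pipe_headE _ _ _ _ (leq0n r)) /=; ring.
split=> //=.
- move=> r rN; rewrite headE; apply/andP; split.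
    rewrite /pipe_head_lo /= upd_eq (upd_neq _ _ jS).
    (* At index 0 the new lower bound is the shifted head itself; elsewhere the maximality of the
       gap at [r0] applies. *)
    have := maxr r rN; rewrite {1}/trial_gap /shifted_head /pipe_head_lo.
    by case: eqVneq => [->|_] //; lra.
  have [//|ex] := leP (shifted_head P b j r0 r) (pipe_head_hi P b j r).
  by case: noex; exists r.
- rewrite !upd_eq; split; first by rewrite le_max lexx orbT.
  by rewrite ge_min lexx orbT.
- by rewrite (upd_neq _ _ jS); apply: pr; rewrite Tle lexx.
Qed.

Lemma tighten_settled (b : bounds R) (j : nat) (h : R) :
  Hout_lo b j <= h -> settled_after b j -> settled_after (tighten P z j h b) j.
Proof.
move=> le_h; apply: settled_after_upd; first exact: tighten_le.
  by move=> k jk; split; rewrite //= upd_neq// gtn_eqF.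
by move=> k /ltnW jk; split; rewrite //= upd_neq// gtn_eqF.
Qed.

Lemma config_invariant_step (c c' : config R) :
  step P z c c' -> invariant c -> invariant c'.
Proof.
move=> st [le0 reg]; case: st le0 reg => /=.
- by move=> b le0 reg [_ sa /(_ erefl) st1]; split.
- move=> j b b' j0 dp le0 reg [jN sa _]; split.
  + exact: bounds_le_trans le0 (domain_propagation_le dp).
  + by rewrite -reg; case: dp.
  + split; last by case: dp.
      by rewrite /is_pipe j0/=; lia.
    exact: domain_propagation_settled dp sa.
- move=> j b r0 r1 tr ex r10 le0 reg [hj sa pr]; split=> //=.
  exact: exceeds_before_infeasible tr ex r10.
- move=> j b r0 r1 tr ex r01 unsolv le0 reg [hj sa pr]; split=> //=.
  exact: exceeds_unsolvable_infeasible ex r01 unsolv.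
- move=> j b r0 r1 u tr ex r01 sol le0 reg [hj sa pr].
  have /ltW lt_v := backward_temp_lt_Tout_hi hP hj tr ex r01 sol.
  split=> /=.
  + exact: bounds_le_trans le0 (lower_Tout_le lt_v).
  + by rewrite -reg; apply: lower_Tout_region tr ex r01 sol.
  + split=> //; last exact: lower_Tout_propagated.
    apply: settled_after_upd sa => //; first exact: lower_Tout_le.
    by move=> k jk; split; rewrite //= upd_neq// gtn_eqF.
- move=> j b r0 tr noex le0 reg [hj sa pr]; have le_h := trial_shift_ge tr.
  split=> /=.
  + exact: bounds_le_trans le0 (tighten_le _ _ le_h).
  + by rewrite -reg; apply: tighten_region.
  + by split=> //; [exact: tighten_settled|exact: within_settled].
- by move=> j b cr le0 reg _; split=> //=; exact: crossed_infeasible.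
- move=> j b ncr le0 reg [hj sa sj]; split=> //=.
  have Tle k : is_pipe P k -> Tout_lo b k <= Tout_hi b k.
    move=> hk; rewrite leNgt; apply/negP => lt_k; apply: ncr.
    by apply: Or32; exists k; split=> //; right.
  split; first by move: hj; rewrite /is_pipe; lia.
    move=> k hk jk; have [|kj] := ltnP j k; first exact: sa.
    have -> : k = j by lia.
    exact/sj/Tle.
  move=> j1; have st1 : is_station P 1 by move: hj; rewrite /is_pipe /is_station; lia.
  by rewrite !leNgt; split; apply/negP => lt1; apply: ncr; apply: Or31;
    exists 1%N; split=> //; [left|right].
Qed.

(** All pumps run at full capacity and each heater bridges the gap up to [Tout_hi]. Inlet values
    come from the preceding pipe, except at station 1, where they are read off the bounds. *)
Definition settled_scheme (b : bounds R) : scheme R :=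
  let Hin k := if k == 1%N then Hin_hi b 1 else trial_head P b k.-1 (NP P k.-1) in
  let Tin k := if k == 1%N then Tin_hi b 1
               else pipe_temp P k.-1 (Tout_hi b k.-1) (NP P k.-1) in
  Scheme (fun k => (x_hi z k)%:~R) (fun k => (y_hi z k)%:~R)
    (fun k => (y_hi z k)%:~R * HSP_hi P k)
    (fun k => Tout_hi b k - Tin k) (Hout_lo b) (Tout_hi b) Hin Tin
    (trial_head P b) (fun k => pipe_temp P k (Tout_hi b k))
    (fun k => pipe_tave P k (Tout_hi b k))
    (fun k => pipe_friction P k (Tout_hi b k)).

Lemma settled_scheme_equality (b : bounds R) :
  settled_after b 0 -> equality_constraints P (settled_scheme b).
Proof.
move=> sa; split.
  move=> j [|r] [hj hr] //; have j0 : (0 < j)%N by move: hj; rewrite /is_pipe; lia.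
  by have [pos _ _ _ _] := sa j hj j0; split=> //=; split=> //; exact: pos.
by case=> // j hj; split=> //=; rewrite addrC subrK.
Qed.

Lemma settled_scheme_inequality (b : bounds R) :
  settled_after b 0 -> Hin_lo b 1 <= Hin_hi b 1 -> Tin_lo b 1 <= Tin_hi b 1 ->
  inequality_constraints P z b (settled_scheme b).
Proof.
move=> sa H1 T1.
have sin k : is_station P k ->
    Hin_lo b k <= sHinS (settled_scheme b) k <= Hin_hi b k /\
    Tin_lo b k <= sTinS (settled_scheme b) k <= Tin_hi b k.
  case: k => [|[|k]] hk //=; first by rewrite H1 T1 !lexx.
  have hk' : is_pipe P k.+1 by move: hk; rewrite /is_pipe /is_station; lia.
  have [_ /(_ _ (leqnn _)) hd _ _ tin] := sa _ hk' isT; split=> //.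
  have /negPf N0 : NP P k.+1 != 0%N by rewrite -lt0n NP_gt0.
  by move: hd; rewrite /pipe_head_lo /pipe_head_hi eqxx N0.
split=> //.
- move=> j hj; have j0 : (0 < j)%N by move: hj; rewrite /is_pipe; lia.
  have hsj : is_station P j by move: hj; rewrite /is_pipe /is_station; lia.
  have [_ _ [hin tin] _ _] := sa j hj j0.
  have [/andP[Hin_ge _] /andP[_ Tin_le]] := sin j hsj.
  have [HCP0 HSP0 le_HSP] := pump_heads hP hj.
  have [xle yle y0] := hz hj.
  have y0R : 0 <= (y_hi z j)%:~R :> R by rewrite ler0z.
  split=> /=; rewrite ?ler_int ?lexx ?xle ?yle//.
  (* Full pumping from any head above [Hin_lo b j] reaches [Hout_lo b j], by the settled condition
     [hin]. *)
  + move: Hin_ge; rewrite /=; lra.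
  + by rewrite ler_wpM2l.
  + by rewrite subr_ge0; exact: le_trans Tin_le tin.
- move=> j hj; have j0 : (0 < j)%N by move: hj; rewrite /is_pipe; lia.
  have [_ /(_ 0%N isT) /= h0 _ Tle _] := sa j hj j0.
  by split=> //=; rewrite Tle lexx.
- move=> j r hj /andP[r0 rN]; have j0 : (0 < j)%N by move: hj; rewrite /is_pipe; lia.
  have [_ /(_ r (ltnW rN)) + _ _ _] := sa j hj j0.
  by rewrite /pipe_head_lo /pipe_head_hi gtn_eqF// ltn_eqF.
Qed.

End Invariant.

Theorem theorem4 (R : realType) (P : hop R) (z : pump_box) (b0 : bounds R)
    (hP : hop_assumptions P) (hz : pump_box_assumptions P z)
    (hb : bounds_assumptions P b0) :
  (forall c : config R, reachable P z b0 c ->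
     feasible_region P z (bounds_of c) = feasible_region P z b0) /\
  (forall (v : verdict) (b : bounds R), reachable P z b0 (Return v b) ->
     (v = Feasible /\
      exists (s : decision R) (psi : scheme R),
        [/\ is_scheme_of P s psi,
            inequality_constraints P z b0 psi &
            forall j : nat, is_pipe P j -> sToutS psi j = Tout_hi b j]) \/
     (v = Infeasible /\ feasible_region P z b0 = set0)).
Proof.
have inv c : reachable P z b0 c -> invariant P z b0 c.
  move=> rc; have {rc} := Operators_Properties.clos_rt_rtn1 _ _ _ _ rc.
  elim=> [|c1 c2 st _].
    split=> //=; split=> //.
      by move=> k hk; move: hk; rewrite /is_pipe; lia.
    (* With a single station the loop is empty and no check is run; the given inlet values of
       station 1 make its bounds coincide. *)
    move=> N1; case: hb => hst _ -> ->; split=> //.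
  exact: config_invariant_step.
split=> [c /inv[]//|v b /inv[/= le0 reg]].
case: v => [[sa [H1 T1]]|reg0]; [left|by right; split=> //; rewrite -reg].
split=> //; exists (decision_of (settled_scheme P z b)), (settled_scheme P z b).
split=> //; first by split=> //; exact: settled_scheme_equality.
(* The final bounds are at least as tight as [b0]. *)
apply: (inequality_constraints_le le0).
exact: settled_scheme_inequality.
Qed.
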